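(* Let $\mathcal{G}=(\mathcal{V},\mathcal{A})$ be a directed network with $n_v$ nodes, arcs $a_1,\dots,a_{n_a}$ and incidence matrix $T$; let $\mathcal{A}_a\subseteq\mathcal{A}$ be a set of attackable arcs, and let $\delta\in\mathbb{R}_+^{n_a}$ with $\delta_j=0$ for $a_j\notin\mathcal{A}_a$. For $x\in\{0,1\}^{n_a}$ define $$\phi'(x)=\min_{\tilde z\in\{0,1\}^{n_a}}\ r^\top(1-\tilde z)+\varphi(x,\tilde z),$$ $$\varphi(x,\tilde z)=\min_{y\in\mathbb{R}^{n_a}}\left\{\big(c+\mathrm{diag}(\delta)(x+\tilde z-1)\big)^\top y:\ Ty\ge d,\ 0\le y\le f\right\}.$$ Then $\phi'$ is submodular for any $c$, $d$, $f$ and $r$ if for any path $P$ in $\mathcal{G}$ and any two (distinct) arcs $a',a''\in\mathcal{A}_a\cap\mathcal{A}_P$, $a'$ and $a''$ have the same direction in $P$.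
   Context: Incidence matrix $T\in\{-1,0,1\}^{n_v\times n_a}$: $t_{ij}=-1$ (resp. $1$) if node $i$ is the tail (resp. head) of arc $j$, and $0$ otherwise. Parameters: $c\in\mathbb{R}^{n_a}$, $d\in\mathbb{R}^{n_v}$, $f\in\mathbb{R}_+^{n_a}$, and repair costs $r\in\mathbb{R}^{n_a}$, $r>0$. $1$ is the all-ones vector. ($\tilde z=1-z$, where $z$ is the defender's binary repair decision.) A path $P$ in $\mathcal{G}$ is a sequence of nodes $(v_0,v_1,\dots,v_k)$ with arcs $(a_1,\dots,a_k)$, $k\ge1$ (here $a_i$ denotes the $i$th arc of the path), such that $v_0,\dots,v_{k-1}\in\mathcal{V}$ are distinct, $v_k\in\mathcal{V}$ is distinct from $v_0$ if $k\le2$ and is distinct from $v_1,\dots,v_{k-1}$ if $k\ge3$, and for each $i$ either $a_i=(v_{i-1},v_i)\in\mathcal{A}$ or $a_i=(v_i,v_{i-1})\in\mathcal{A}$. $\mathcal{A}_P=\{a_1,\dots,a_k\}$. Two arcs $a_i,a_j$ of $P$, $i\ne j$, have the same direction in $P$ if both agree with the forward order of $P$ ($a_i=(v_{i-1},v_i)$, $a_j=(v_{j-1},v_j)$) or both agree with the reverse order. A function $\phi$ on a sublattice is submodular if $\phi(x')+\phi(x'')\ge\phi(x'\vee x'')+\phi(x'\wedge x'')$ for all $x',x''$ (componentwise max/min). Standing assumption (complete recourse): parameters are such that the defender's problem is always feasible and bounded; ''for any $c,d,f,r$'' ranges over such parameters. *)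

(* Defs.v *)
From HB Require Import structures.
From mathcomp Require Import all_boot all_order all_algebra.
From mathcomp Require Import all_classical all_reals.

Set Implicit Arguments.
Unset Strict Implicit.
Unset Printing Implicit Defensive.

Import Order.TTheory GRing.Theory Num.Theory.

Local Open Scope classical_set_scope.
Local Open Scope ring_scope.

(* Arcs are ordered pairs of nodes, listed without repetition: antiparallel
   arcs are allowed, parallel ones are not.  Self-loops are excluded because
   the incidence matrix is not defined for them. *)
Record network (nv na : nat) := Network {
  arc : 'I_na -> 'I_nv * 'I_nv;
  arc_inj : injective arc;
  arc_loopless : forall j, (arc j).1 != (arc j).2
}.

Definition incidence (R : realType) nv na (G : network nv na) : 'M[R]_(nv, na) :=
  \matrix_(i, j) if i == (arc G j).1 then -1
                 else if i == (arc G j).2 then 1 else 0.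

(* A path of length k has nodes v 0, ..., v k and arcs a 1, ..., a k; the values
   of v and a at other indices are irrelevant. *)
Definition forward_arc nv na (G : network nv na)
    (v : nat -> 'I_nv) (a : nat -> 'I_na) (i : nat) : Prop :=
  arc G (a i) = (v i.-1, v i).

Definition reverse_arc nv na (G : network nv na)
    (v : nat -> 'I_nv) (a : nat -> 'I_na) (i : nat) : Prop :=
  arc G (a i) = (v i, v i.-1).

Record is_path nv na (G : network nv na) (k : nat)
    (v : nat -> 'I_nv) (a : nat -> 'I_na) : Prop := IsPath {
  path_length : (1 <= k)%N;
  path_nodes : forall i j, (i < k)%N -> (j < k)%N -> v i = v j -> i = j;
  path_last_short : (k <= 2)%N -> v k <> v 0%N;
  path_last_long : (3 <= k)%N -> forall i, (1 <= i < k)%N -> v k <> v i;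
  path_arcs : forall i, (1 <= i <= k)%N ->
    forward_arc G v a i \/ reverse_arc G v a i
}.

Definition same_direction nv na (G : network nv na)
    (v : nat -> 'I_nv) (a : nat -> 'I_na) (i j : nat) : Prop :=
  (forward_arc G v a i /\ forward_arc G v a j) \/
  (reverse_arc G v a i /\ reverse_arc G v a j).

Definition dotmx (R : realType) n (u w : 'cV[R]_n) : R := (u^T *m w) 0 0.

Definition vle (R : realType) n (u w : 'cV[R]_n) : Prop :=
  forall i, u i 0 <= w i 0.

Definition binary (R : realType) n : set 'cV[R]_n :=
  [set x | forall j, x j 0 = 0 \/ x j 0 = 1].

Arguments binary : clear implicits.

(* L is meant to be closed under the componentwise max and min. *)
Definition submodular (R : realType) n (L : set 'cV[R]_n)
    (g : 'cV[R]_n -> R) : Prop :=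
  forall x y, L x -> L y ->
    g (map2_mx Num.max x y) + g (map2_mx Num.min x y) <= g x + g y.

(* The attained minimum: an element of E that is a lower bound of E; the value
   is the dummy 0 if E has no least element. *)
Definition minimum (R : realType) (E : set R) : R :=
  xget 0 [set m | E m /\ lbound E m].

Definition flows (R : realType) nv na (G : network nv na)
    (d : 'cV[R]_nv) (f : 'cV[R]_na) : set 'cV[R]_na :=
  [set y | [/\ vle d (incidence R G *m y), vle 0 y & vle y f]].

Definition cost (R : realType) na (c delta x z : 'cV[R]_na) : 'cV[R]_na :=
  c + diag_mx delta^T *m (x + z - const_mx 1).

(* In the following definitions z is the complement of the repair decision. *)
Definition flow_value (R : realType) nv na (G : network nv na)
    (delta c : 'cV[R]_na) (d : 'cV[R]_nv) (f x z : 'cV[R]_na) : R :=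
  minimum [set dotmx (cost c delta x z) y | y in flows G d f].

Definition attack_value (R : realType) nv na (G : network nv na)
    (delta c : 'cV[R]_na) (d : 'cV[R]_nv) (f r x : 'cV[R]_na) : R :=
  minimum [set dotmx r (const_mx 1 - z) + flow_value G delta c d f x z
          | z in binary R na].

(* For every attack x, the defender's problem, a joint minimization over the
   repair decision and the flow, is feasible and bounded. *)
Definition complete_recourse (R : realType) nv na (G : network nv na)
    (delta c : 'cV[R]_na) (d : 'cV[R]_nv) (f r : 'cV[R]_na) : Prop :=
  forall x, binary R na x ->
    has_inf [set dotmx r (const_mx 1 - p.1) + dotmx (cost c delta x p.1) p.2
            | p in binary R na `*` flows G d f].

(* Main.v *)
From mathcomp Require Import all_boot all_order all_algebra.
From mathcomp Require Import all_classical all_reals.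
From mathcomp Require Import topology normedtype derive.
From mathcomp Require Import lra.
Require Import Defs.

(** The attack value is a joint minimum, over the complement z of the repair
    decision and the flow y, of r.(1 - z) + (c + delta (x + z - 1)).y, and
    this minimum is attained: z ranges over a finite set and y over a compact
    polytope ([attack_value_attained]). Submodularity is then an exchange
    argument. Let (z, y) be optimal for x and (z', y') optimal for x'. It is
    enough to rearrange y and y' into two feasible flows u and u' with u + u'
    = y + y' such that u = min (y, y') and u' = max (y, y') on the attackable
    arcs: the pairs (max (z, z'), u) and (min (z, z'), u') are feasible for
    the attacks max (x, x') and min (x, x'), and arc by arc the rearrangement
    inequality [rearrangement], applied to x against y and to z against y,
    shows that they cost together at most as much as (z, y) and (z', y'). On
    the arcs that are not attackable the cost does not depend on x and z, so
    only u + u' matters there.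

    The rearrangement ([flows_exchange]) comes from decomposing the flow g =
    y' - y. Orient every arc in the direction in which g uses it, and add a
    root that supplies the nodes where g has an excess outflow and absorbs the
    excess inflow of the others; |g| becomes a nonnegative circulation, which
    is a combination of simple cycles with positive coefficients. A simple
    cycle, once opened at the root if it visits it, is a path of the network,
    unless it consists of two antiparallel arcs. By hypothesis in the former
    case, and obviously in the latter, its attackable arcs agree: either g is
    nonnegative on all of them or it is negative on all of them
    ([same_dir_simple_cycle]). Let h be the part of g carried by the cycles of
    the second kind (those without attackable arcs can be put in either kind).
    Then h = min (0, g) on the attackable arcs, while h lies between 0 and g
    on every arc and its net inflow lies between 0 and that of g at every node
    ([conformal_split]). Hence u = y + h and u' = y' - h are between y and y',
    as are their net inflows, so that they are feasible. *)

Set Implicit Arguments.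
Unset Strict Implicit.
Unset Printing Implicit Defensive.

Import Order.TTheory GRing.Theory Num.Theory.
Import numFieldTopology.Exports numFieldNormedType.Exports.

Local Open Scope ring_scope.

(** * Decomposition of circulations *)

Definition net_inflow (R : realDomainType) (V E : finType) (src tgt : E -> V)
    (q : E -> R) (v : V) : R :=
  \sum_e q e * ((tgt e == v)%:R - (src e == v)%:R).

Definition circulation (R : realDomainType) (V E : finType) (src tgt : E -> V)
    (q : E -> R) : Prop :=
  (forall e, 0 <= q e) /\ (forall v, net_inflow src tgt q v = 0).

(** The empty sequence counts as a simple cycle. *)
Definition simple_cycle (V E : eqType) (src tgt : E -> V) (es : seq E) : bool :=
  uniq (map src es) && cycle (fun e e' => tgt e == src e') es.

Lemma map_tgt_cycle (V E : eqType) (src tgt : E -> V) (es : seq E) :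
  cycle (fun e e' => tgt e == src e') es ->
  map tgt es = rot 1 (map src es).
Proof.
case: es => // e0 es /=; rewrite rot1_cons -map_rcons -map_cons.
rewrite -(belast_rcons e0 es e0).
move: (rcons es e0) => s; elim: s e0 => //= e s IH e1 /andP[/eqP-> /IH].
by case: s {IH} => //= e' s ->.
Qed.

Lemma net_inflow_cycle (R : realDomainType) (V E : finType) (src tgt : E -> V)
    (es : seq E) (v : V) :
  simple_cycle src tgt es ->
  net_inflow src tgt (fun e => (e \in es)%:R : R) v = 0.
Proof.
move=> /andP[us /map_tgt_cycle tgtE].
have ues := map_uniq us.
rewrite /net_inflow.
under eq_bigr do rewrite mulr_natl mulrb.
rewrite -big_mkcond -big_uniq //= sumrB.
rewrite -(big_map tgt xpredT (fun w => (w == v)%:R)).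
rewrite -(big_map src xpredT (fun w => (w == v)%:R)) tgtE.
by apply/eqP; rewrite subr_eq0; apply/eqP/perm_big; rewrite perm_rot.
Qed.

(** Conservation provides an arc with positive flow out of the head of every
    such arc, so one can follow the flow from node to node; since there are
    finitely many nodes, the walk ends up repeating a simple cycle. *)
Lemma circulation_has_cycle (R : realDomainType) (V E : finType)
    (src tgt : E -> V) (q : E -> R) (e0 : E) :
  circulation src tgt q -> 0 < q e0 ->
  exists2 es, simple_cycle src tgt es
    & es != [::] /\ forall e, e \in es -> 0 < q e.
Proof.
move=> [q0 qn] qe0.
pose good v := [exists e, (src e == v) && (0 < q e)].
pose out v := odflt e0 [pick e | (src e == v) && (0 < q e)].
pose next v := tgt (out v).
have outP v : good v -> src (out v) = v /\ 0 < q (out v).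
  rewrite /out; case: pickP => [e /andP[/eqP]|none /existsP[e]] //.
  by rewrite none.
have good_tgt e : 0 < q e -> good (tgt e).
  move=> qe; apply: contraT; rewrite negb_exists => /forallP noout.
  (* without outgoing flow, the flow of [e] makes the net inflow positive *)
  have := qn (tgt e); rewrite /net_inflow => sum0.
  have : 0 < \sum_e' q e' * ((tgt e' == tgt e)%:R - (src e' == tgt e)%:R).
    rewrite (bigD1 e) //=; apply: ltr_wpDr.
      apply: sumr_ge0 => e' _.
      have := noout e'; case: (src e' == _) => /=.
        by rewrite lt_def q0 andbT negbK => /eqP->; rewrite mul0r.
      by rewrite subr0 mulr_ge0.
    have := noout e; case: (src e == _) => /=; first by rewrite qe.
    by rewrite eqxx subr0 mulr1.
  by rewrite sum0 ltxx.
have good_next v : good v -> good (next v).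
  by move=> /outP[_ /good_tgt].
have good_iter n v : good v -> good (iter n next v).
  by move=> gv; elim: n => //= n; apply: good_next.
pose x := src e0.
have gx : good x by apply/existsP; exists e0; rewrite eqxx.
(* the first node to be repeated starts the cycle *)
have /trajectP[i lt_in iterE] := looping_order next x.
set w := iter i next x in iterE.
have gw : good w by exact: good_iter.
have cyc : fcycle next (orbit next w).
  apply/(orbitPcycle 0%N 3%N); exists (order next x - i)%N.-1.
  by rewrite prednK ?subn_gt0 // {1}/w -iterD subnK ?iterE // ltnW.
have gorb v : v \in orbit next w -> good v.
  by move=> /trajectP[n _ ->]; exact: good_iter.
have srcK : map src (map out (orbit next w)) = orbit next w.
  rewrite -map_comp -[RHS]map_id; apply/eq_in_map => v /gorb /outP[].
  by [].
exists (map out (orbit next w)); last split.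
- rewrite /simple_cycle srcK orbit_uniq /= cycle_map.
  apply: sub_in_cycle cyc; last exact/allP/gorb.
  by move=> v v' _ /outP[srcE _] /eqP nextE /=; rewrite srcE -nextE.
- by rewrite -size_eq0 size_map size_orbit -orderSpred.
- by move=> e /mapP[v /gorb /outP[_ ?] ->].
Qed.

(** The decomposition of circulations into simple cycles, in the form in which
    it is used: peel off simple cycles, with the largest coefficient that keeps
    the flow nonnegative, and collect those that meet [P] in [q1] and the others
    in [q2].  Each step makes the flow vanish on some arc of the cycle. *)
Lemma circulation_split (R : realDomainType) (V E : finType)
    (src tgt : E -> V) (P N : pred E) (q : E -> R) :
  (forall es, simple_cycle src tgt es -> ~~ (has P es && has N es)) ->
  circulation src tgt q ->
  exists q1 q2 : E -> R,
    [/\ circulation src tgt q1, circulation src tgt q2,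
        forall e, q e = q1 e + q2 e,
        forall e, N e -> q1 e = 0 & forall e, P e -> q2 e = 0].
Proof.
move=> noPN; have [n] := ubnP #|[pred e | 0 < q e]|.
have netD t (a b : E -> R) v : net_inflow src tgt (fun e => a e + t * b e) v
    = net_inflow src tgt a v + t * net_inflow src tgt b v.
  rewrite /net_inflow mulr_sumr -big_split /=.
  by apply: eq_bigr => e _; rewrite mulrDl mulrA.
elim: n q => // n IH q le_n cq; have [q0 qn] := cq.
have [e0 qe0|none] := pickP [pred e | 0 < q e]; last first.
  have qz e : q e = 0.
    by have /= := none e; rewrite lt_def q0 andbT => /negbFE /eqP.
  by exists q, q; split=> // e; rewrite qz addr0.
have [es ces [esn0 qes]] := circulation_has_cycle cq qe0.
have netC := net_inflow_cycle R _ ces.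
have [e1 e1es e1min] : exists2 e1, e1 \in es &
    forall e, e \in es -> q e1 <= q e.
  case: es esn0 {ces qes netC} => // e es _.
  case: (arg_minP q (mem_head e es)) => e1 ? min.
  by exists e1.
pose C e : R := (e \in es)%:R.
have cC t (a : E -> R) : 0 <= t -> circulation src tgt a ->
    circulation src tgt (fun e => a e + t * C e).
  move=> t0 [a0 an]; split=> [e|v]; first by rewrite addr_ge0 ?mulr_ge0.
  by rewrite netD an netC mulr0 addr0.
have qe1 : 0 < q e1 by exact: qes.
have [||q1 [q2 [c1 c2 qE q1N q2P]]] := IH (fun e => q e + - q e1 * C e).
- rewrite -ltnS; apply: leq_trans le_n; rewrite ltnS.
  apply: proper_card; apply/properP; split; last first.
    by exists e1; rewrite !inE // /C e1es mulr1 subrr ltxx.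
  apply/fintype.subsetP => e; rewrite !inE; apply: contraTT.
  rewrite -!leNgt => qe; rewrite (le_trans _ qe) //.
  by rewrite gerDl mulNr oppr_le0 mulr_ge0 // ltW.
- split=> [e|v]; last by rewrite netD qn netC mulr0 addr0.
  rewrite /C; case: (boolP (e \in es)) => [/e1min|]; last first.
    by rewrite mulr0 addr0.
  by rewrite mulr1 subr_ge0.
have qE' e : q e = q1 e + q2 e + q e1 * C e.
  by rewrite -qE mulNr subrK.
have := noPN _ ces; rewrite negb_and => /orP[] /hasPn none.
- exists q1, (fun e => q2 e + q e1 * C e); split=> //.
  + by apply: cC => //; exact: ltW.
  + by move=> e; rewrite qE' addrA.
  + move=> e Pe; rewrite q2P // add0r /C; case: (boolP (e \in es)) => [/none|].
      by rewrite Pe.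
    by rewrite mulr0.
- exists (fun e => q1 e + q e1 * C e), q2; split=> //.
  + by apply: cC => //; exact: ltW.
  + by move=> e; rewrite qE' addrAC.
  + move=> e Ne; rewrite q1N // add0r /C; case: (boolP (e \in es)) => [/none|].
      by rewrite Ne.
    by rewrite mulr0.
Qed.

(** * Cycles of the rooted network *)

(** [o j] tells whether arc [j] is traversed from its tail to its head. *)
Definition otail nv na (G : network nv na) (o : 'I_na -> bool) (j : 'I_na) :=
  if o j then (arc G j).1 else (arc G j).2.

Definition ohead nv na (G : network nv na) (o : 'I_na -> bool) (j : 'I_na) :=
  if o j then (arc G j).2 else (arc G j).1.

Lemma oarcE nv na (G : network nv na) o (j : 'I_na) :
  arc G j = if o j then (otail G o j, ohead G o j)
            else (ohead G o j, otail G o j).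
Proof. by rewrite /otail /ohead; case: (o j); case: (arc G j). Qed.

Lemma otail_neq_ohead nv na (G : network nv na) o (j : 'I_na) :
  otail G o j != ohead G o j.
Proof.
have := arc_loopless G j; rewrite /otail /ohead.
by case: (o j) => //; rewrite eq_sym.
Qed.

Definition same_dir_paths nv na (G : network nv na) (A : {set 'I_na}) : Prop :=
  forall (k : nat) (v : nat -> 'I_nv) (a : nat -> 'I_na), is_path G k v a ->
  forall i j : nat, (1 <= i <= k)%N -> (1 <= j <= k)%N ->
    a i \in A -> a j \in A -> a i != a j -> same_direction G v a i j.

(** The nodes of the walk are distinct, except that it may return to its
    starting point.  It is then a path in which an arc is forward when [o] keeps
    its orientation and reverse otherwise, and the hypothesis on paths applies,
    unless the walk is closed and of length at most 2: those are not paths. *)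
Lemma same_dir_walk nv na (G : network nv na) (A : {set 'I_na}) o
    (j0 : 'I_na) (js : seq 'I_na) :
  same_dir_paths G A ->
  path (fun j j' => ohead G o j == otail G o j') j0 js ->
  uniq (map (otail G o) (j0 :: js)) ->
  ohead G o (last j0 js) \notin map (otail G o) (j0 :: js) \/
    ohead G o (last j0 js) = otail G o j0 ->
  {in j0 :: js &, forall a b, a \in A -> b \in A -> o a = o b}.
Proof.
move=> sameA chain usrc lastP a b aj bj aA bA.
have [->//|neq_ab] := eqVneq a b.
set t := ohead _ _ (last _ _) in lastP *.
pose k := (size js).+1.
(* The indexing is that of paths: arc [e i] leads from [v i.-1] to [v i]. *)
pose v i := if (i < k)%N then otail G o (nth j0 (j0 :: js) i) else t.
pose e i := nth j0 (j0 :: js) i.-1.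
have tailE i : (1 <= i <= k)%N -> otail G o (e i) = v i.-1.
  by case: i => // i; rewrite /= => ik; rewrite /v /e /= ik.
have headE i : (1 <= i <= k)%N -> ohead G o (e i) = v i.
  case: i => // i ik; rewrite /v /e ltnS /=; case: ltnP => [lt_i|ge_i].
    by have /pathP-/(_ j0 i lt_i)/eqP := chain.
  have -> : i = size js by apply/eqP; rewrite eqn_leq ge_i andbT.
  by rewrite /t -nth_last; case: (js).
have vE i : (i < k)%N ->
    v i = nth (otail G o j0) (map (otail G o) (j0 :: js)) i.
  by move=> ik; rewrite (nth_map j0) // /v ik.
have v_inj i j : (i < k)%N -> (j < k)%N -> v i = v j -> i = j.
  move=> ik jk; rewrite !vE // => /eqP; rewrite nth_uniq ?size_map // => /eqP.
  by [].
have vk : v k = t by rewrite /v ltnn.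
have arcE i : (1 <= i <= k)%N ->
    arc G (e i) = if o (e i) then (v i.-1, v i) else (v i, v i.-1).
  by move=> ik; rewrite (oarcE G o) tailE ?headE.
have indexE c : c \in j0 :: js ->
    exists2 i, (1 <= i <= k)%N & e i = c.
  move=> cj; exists (index c (j0 :: js)).+1; last by rewrite /e nth_index.
  by rewrite -index_mem in cj.
have fwdE i : (1 <= i <= k)%N -> forward_arc G v e i -> o (e i).
  move=> ik; rewrite /forward_arc arcE //; case: (o (e i)) => // -[/eqP].
  by rewrite -tailE // -headE // eq_sym (negPf (otail_neq_ohead _ _ _)).
have revE i : (1 <= i <= k)%N -> reverse_arc G v e i -> o (e i) = false.
  move=> ik; rewrite /reverse_arc arcE //; case: (o (e i)) => // -[/eqP].
  by rewrite -tailE // -headE // (negPf (otail_neq_ohead _ _ _)).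
have [|long] := boolP ((k <= 2)%N && (t == otail G o j0)); last first.
  have pathP : is_path G k v e.
    split=> //.
    - by move=> k2 vk0; move: long; rewrite k2 -vk vk0 /v /= eqxx.
    - move=> k3 i /andP[i1 ik]; rewrite vk => tE.
      case: lastP => [/negP[]|t0].
        by rewrite tE vE // mem_nth // size_map.
      suff : i = 0%N by move=> i0; rewrite i0 in i1.
      by apply: v_inj => //; rewrite -tE t0 /v.
    - move=> i ik; rewrite /forward_arc /reverse_arc arcE //.
      by case: (o _); [left|right].
  have [i ik ia] := indexE _ aj; have [j jk jb] := indexE _ bj.
  have := sameA _ _ _ pathP i j ik jk; rewrite ia jb => /(_ aA bA neq_ab).
  rewrite -ia -jb; case=> -[].
    by move=> /(fwdE _ ik)-> /(fwdE _ jk)->.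
  by move=> /(revE _ ik)-> /(revE _ jk)->.
(* Two arcs that close up a cycle and are oriented differently by [o] have the
   same tail and the same head, so they are equal. *)
move=> /andP[]; rewrite /k /t {v e k tailE headE vE v_inj vk arcE indexE
  fwdE revE lastP t}.
have antipar c c' : ohead G o c = otail G o c' ->
    ohead G o c' = otail G o c -> c != c' -> o c = o c'.
  move=> cc' c'c; apply: contraNeq => noo; apply/eqP/(@arc_inj _ _ G).
  rewrite (oarcE G o c) (oarcE G o c') cc' c'c.
  by move: noo; case: (o c); case: (o c').
move: js chain {usrc} aj bj => [|j1 [|//]] /=.
  by rewrite !inE => _ /eqP aE /eqP bE; rewrite aE bE eqxx in neq_ab.
rewrite andbT !inE => /eqP t01 aj bj _ /eqP t10.
have o01 : j0 != j1 -> o j0 = o j1 by exact: antipar.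
move: aj bj neq_ab => /orP[] /eqP-> /orP[] /eqP->; rewrite ?eqxx //.
by rewrite eq_sym => /o01.
Qed.

(** The rooted network has the root [None] as an additional node and one
    additional arc [inr i] between each node [i] and the root, which leads to
    the root when [s i] holds and comes from it otherwise. *)
Definition rtail nv na (G : network nv na) (o : 'I_na -> bool)
    (s : 'I_nv -> bool) (e : 'I_na + 'I_nv) : option 'I_nv :=
  match e with
  | inl j => Some (otail G o j)
  | inr i => if s i then Some i else None
  end.

Definition rhead nv na (G : network nv na) (o : 'I_na -> bool)
    (s : 'I_nv -> bool) (e : 'I_na + 'I_nv) : option 'I_nv :=
  match e with
  | inl j => Some (ohead G o j)
  | inr i => if s i then None else Some i
  end.

Lemma all_inl (A B : eqType) (es : seq (A + B)) :
  (forall e, e \in es -> exists a, e = inl a) -> exists xs, es = map inl xs.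
Proof.
elim: es => [|e es IH] allE; first by exists [::].
have [a ->] := allE e (mem_head _ _).
have [|xs ->] := IH; last by exists (a :: xs).
by move=> e' e's; apply: allE; rewrite inE e's orbT.
Qed.

(** A simple cycle visits the root at most once, so it is either a closed walk
    of the network or, opened at the root, a walk without repeated nodes. *)
Lemma same_dir_simple_cycle nv na (G : network nv na) (A : {set 'I_na}) o s
    (es : seq ('I_na + 'I_nv)) (a b : 'I_na) :
  same_dir_paths G A ->
  simple_cycle (rtail G o s) (rhead G o s) es ->
  inl a \in es -> inl b \in es -> a \in A -> b \in A -> o a = o b.
Proof.
move=> sameA; have someE e : rtail G o s e != None -> rhead G o s e != None ->
    exists j, e = inl j.
  by case: e => [j|i] /=; [exists j|case: (s i)].
have [noroot|/negbNE/mapP[e0 e0es e0T]] :=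
  boolP (None \notin map (rtail G o s) es).
  move=> /andP[us cyc] aes bes aA bA; have hd := map_tgt_cycle cyc.
  have [e ees|js jsE] := @all_inl _ _ es.
    apply: someE; apply: contraNneq noroot => <-; first exact: map_f.
    by rewrite -(mem_rot 1) -hd map_f.
  move: us cyc aes bes; rewrite jsE cycle_map -map_comp.
  rewrite !(mem_map inl_inj).
  case: js {jsE} => // j0 js us cyc aj bj.
  apply: (same_dir_walk sameA _ _ _ aj bj) => //.
  - by move: cyc => /=; rewrite rcons_path => /andP[].
  - by rewrite (map_comp Some) (map_inj_uniq Some_inj) in us.
  - by right; move: cyc => /=; rewrite rcons_path => /andP[_ /eqP[]].
(* Start the cycle at the root: [e0] leaves it, [e1] returns to it, and the arcs
   in between belong to the network. *)
have [i es' rotE] := rot_to e0es.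
rewrite -!(mem_rot i es) /simple_cycle -(rot_uniq i) -map_rot.
rewrite -(rot_cycle i) rotE.
move=> /andP[us cyc]; have hd := map_tgt_cycle cyc.
have := hd; rewrite /= rot1_cons -e0T.
case/lastP: es' us cyc {rotE hd} => [|es' e1] us cyc.
  by case: e0 {us e0es cyc} e0T => //= v; case: (s v).
rewrite map_rcons -rcons_cons => /rcons_inj[hd e1H].
have [e ees|js jsE] := @all_inl _ _ es'.
  apply: someE.
    move: us => /= /andP[+ _]; rewrite -e0T map_rcons mem_rcons inE negb_or.
    by move=> /andP[_]; apply: contraNneq => <-; exact: map_f.
  move: us => /= /andP[+ _]; rewrite -e0T; apply: contraNneq => <-.
  by rewrite -hd inE map_f ?orbT.
have [i0 e0E] : exists i, e0 = inr i by case: (e0) e0T => // i0; exists i0.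
have [i1 e1E] : exists i, e1 = inr i /\ rtail G o s e1 = Some i.
  by case: (e1) e1H => //= i1; case: (s i1) => //; exists i1.
case: e1E => e1E e1T; rewrite jsE !inE !mem_rcons !inE e0E e1E /=.
rewrite !(mem_map inl_inj) => aj bj aA bA.
case: js jsE aj bj => // j0 js jsE aj bj.
move: us; rewrite map_cons cons_uniq map_rcons rcons_uniq e1T jsE -map_comp.
rewrite (map_comp Some) mem_map; last exact: Some_inj.
rewrite (map_inj_uniq Some_inj) => /and3P[_ i1js us].
move: cyc; rewrite jsE rcons_cons /= !rcons_path /= last_map path_map /= e1T.
rewrite -andbA => /and4P[_ chain /eqP[headE] _].
by apply: (same_dir_walk sameA chain us _ aj bj aA bA); left; rewrite headE.
Qed.

(** * Conformal splitting of flows *)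

Definition signed (R : zmodType) (b : bool) (t : R) : R := if b then t else - t.

Lemma signed_norm (R : realDomainType) (t : R) : signed (0 <= t) `|t| = t.
Proof. by rewrite /signed; case: ger0P => // _; rewrite opprK. Qed.

Lemma sum_net_inflow (R : realDomainType) (V E : finType) (src tgt : E -> V)
    (q : E -> R) :
  \sum_v net_inflow src tgt q v = 0.
Proof.
rewrite exchange_big big1 //= => e _; rewrite -mulr_sumr sumrB.
have one (w : V) : \sum_v (w == v)%:R = 1 :> R.
  rewrite (bigD1 w) //= eqxx big1 ?addr0 // => v.
  by rewrite eq_sym => /negPf->.
by rewrite !one subrr mulr0.
Qed.

(** A flow of the rooted network that is conserved at [i] has, up to sign, the
    net inflow of its network part on arc [inr i]. *)
Lemma net_inflow_node (R : realType) nv na (G : network nv na) o s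
    (q : 'I_na + 'I_nv -> R) (i : 'I_nv) :
  net_inflow (rtail G o s) (rhead G o s) q (Some i)
  = (incidence R G *m \col_j signed (o j) (q (inl j))) i 0
    - signed (s i) (q (inr i)).
Proof.
rewrite /net_inflow big_sumType /=; congr (_ + _).
  rewrite mxE; apply: eq_bigr => j _; rewrite !mxE /signed /otail /ohead.
  rewrite ![Some _ == Some _](inj_eq Some_inj) ![_ == i]eq_sym.
  have := arc_loopless G j; have [->|] := eqVneq i (arc G j).1.
    by move=> /negPf neq; case: (o j); rewrite eqxx neq /=;
      rewrite ?sub0r ?subr0 ?mulr1 ?mulrN1 ?mulN1r ?opprK.
  move=> /negPf neq _; case: (o j); rewrite neq; case: (i == _) => /=;
    by rewrite ?subrr ?sub0r ?subr0 ?mulr0 ?mul0r ?mulr1 ?mul1r ?mulrN1.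
rewrite (bigD1 i) //= big1 ?addr0 => [|i' i'i].
  by rewrite /signed; case: (s i);
    rewrite eqxx ?sub0r ?subr0 ?mulr1 ?mulrN1 ?opprK.
by case: (s i') => /=; rewrite (inj_eq Some_inj) (negPf i'i) subrr mulr0.
Qed.

Definition conformal (R : realDomainType) (h g : R) : Prop :=
  0 <= h <= g \/ g <= h <= 0.

Lemma conformal_signed (R : realDomainType) (t p : R) :
  0 <= p <= `|t| -> conformal (signed (0 <= t) p) t.
Proof.
move=> /andP[p0 pt]; rewrite /signed; case: (ger0P t) pt => t0 pt.
  by left; rewrite p0.
by right; rewrite oppr_le0 p0 andbT lerNr.
Qed.

(** Decompose [g] into cycles of the rooted network: [h] is carried by those
    that avoid the arcs of [A] where [g] is nonnegative, and the other ones
    avoid the arcs of [A] where [g] is negative. As all cycles use an arc in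
    the direction of [g], including the arcs to the root, whose flow is the
    net inflow, no cancellation occurs. *)
Lemma conformal_split (R : realType) nv na (G : network nv na)
    (A : {set 'I_na}) (g : 'cV[R]_na) :
  same_dir_paths G A ->
  exists h : 'cV[R]_na,
    [/\ forall j, conformal (h j 0) (g j 0),
        forall i, conformal ((incidence R G *m h) i 0)
                            ((incidence R G *m g) i 0)
      & forall j, j \in A -> h j 0 = Num.min 0 (g j 0)].
Proof.
move=> sameA; set T := incidence R G.
pose o j := 0 <= g j 0; pose s i := 0 <= (T *m g) i 0.
pose q (e : 'I_na + 'I_nv) : R :=
  match e with inl j => `|g j 0| | inr i => `|(T *m g) i 0| end.
have gE : \col_j signed (o j) (q (inl j)) = g.
  by apply/colP => j; rewrite mxE signed_norm.
have qSome i : net_inflow (rtail G o s) (rhead G o s) q (Some i) = 0.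
  by rewrite net_inflow_node gE signed_norm subrr.
have cq : circulation (rtail G o s) (rhead G o s) q.
  split=> [[j|i]|[i|]] //=.
  (* conservation at the root follows from conservation at all other nodes *)
  have := sum_net_inflow (rtail G o s) (rhead G o s) q.
  by rewrite (bigD1 None) //= big1 ?addr0 // => -[].
pose P (e : 'I_na + 'I_nv) := if e is inl j then (j \in A) && o j else false.
pose N (e : 'I_na + 'I_nv) := if e is inl j then (j \in A) && ~~ o j else false.
have noPN es : simple_cycle (rtail G o s) (rhead G o s) es ->
    ~~ (has P es && has N es).
  move=> ces; apply/negP => /andP[/hasP[[a|//] aes /andP[aA oa]]].
  move=> /hasP[[b|//] bes /andP[bA /negP[]]].
  by rewrite -(same_dir_simple_cycle sameA ces aes bes aA bA).
have [q1 [q2 [[q1_ge0 _] [q2_ge0 q2n] qE q1N q2P]]] :=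
  circulation_split noPN cq.
have q2_le e : 0 <= q2 e <= q e by rewrite q2_ge0 qE lerDr q1_ge0.
exists (\col_j signed (o j) (q2 (inl j))); split=> [j|i|j jA].
- by rewrite mxE; exact: conformal_signed (q2_le (inl j)).
- have /eqP := q2n (Some i); rewrite net_inflow_node subr_eq0 => /eqP->.
  exact: conformal_signed (q2_le (inr i)).
- rewrite mxE; case: (boolP (o j)) => oj; rewrite /signed.
    by rewrite q2P /= ?jA // min_l.
  have := qE (inl j); rewrite q1N /= ?jA // add0r => <-.
  rewrite -ltNge in oj.
  by rewrite ltr0_norm // opprK min_r // ltW.
Qed.

(** Transfer to [y], and away from [y'], the part of [y' - y] that lowers [y] on
    the arcs of [A]: this yields the minimum on these arcs, and everywhere a
    value between those of [y] and [y'], for the flow and for its net inflow. *)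
Lemma flows_exchange (R : realType) nv na (G : network nv na)
    (A : {set 'I_na}) (d : 'cV[R]_nv) (f y y' : 'cV[R]_na) :
  same_dir_paths G A -> flows G d f y -> flows G d f y' ->
  exists u u' : 'cV[R]_na,
    [/\ flows G d f u, flows G d f u', u + u' = y + y',
        forall j, j \in A -> u j 0 = Num.min (y j 0) (y' j 0)
      & forall j, j \in A -> u' j 0 = Num.max (y j 0) (y' j 0)].
Proof.
move=> sameA [dy y0 yf] [dy' y'0 y'f].
have [h [hc Thc hA]] := conformal_split (y' - y) sameA.
have diffE j : (y' - y) j 0 = y' j 0 - y j 0 by rewrite !mxE.
have TdiffE i : (incidence R G *m (y' - y)) i 0
    = (incidence R G *m y') i 0 - (incidence R G *m y) i 0.
  by rewrite mulmxBr mxE [X in _ + X]mxE.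
exists (y + h), (y' - h); split.
- split.
  + move=> i; rewrite mulmxDr mxE.
    have := Thc i; rewrite TdiffE /conformal.
    by have := dy i; have := dy' i; lra.
  + move=> j; rewrite [(y + h) _ _]mxE.
    by have := hc j; rewrite diffE /conformal; have := y0 j; have := y'0 j; lra.
  + move=> j; rewrite [(y + h) _ _]mxE.
    by have := hc j; rewrite diffE /conformal; have := yf j; have := y'f j; lra.
- split.
  + move=> i; rewrite mulmxBr mxE [X in _ + X]mxE.
    have := Thc i; rewrite TdiffE /conformal.
    by have := dy i; have := dy' i; lra.
  + move=> j; rewrite [(y' - h) _ _]mxE [X in _ + X]mxE.
    by have := hc j; rewrite diffE /conformal; have := y0 j; have := y'0 j; lra.
  + move=> j; rewrite [(y' - h) _ _]mxE [X in _ + X]mxE.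
    by have := hc j; rewrite diffE /conformal; have := yf j; have := y'f j; lra.
- by rewrite addrACA subrr addr0.
- move=> j jA; rewrite mxE hA // diffE addr_minr addr0.
  by rewrite addrC subrK.
- move=> j jA; rewrite mxE [X in _ + X]mxE hA // diffE oppr_min oppr0.
  by rewrite addr_maxr addr0 opprB addrC subrK maxC.
Qed.

(** * Existence of optimal decisions *)

Local Open Scope classical_set_scope.

Lemma dotmxE (R : realType) n (u w : 'cV[R]_n) :
  dotmx u w = \sum_j u j 0 * w j 0.
Proof. by rewrite /dotmx mxE; apply: eq_bigr => j _; rewrite mxE. Qed.

Lemma minimumP (R : realType) (E : set R) (m : R) :
  E m -> lbound E m -> minimum E = m.
Proof.
move=> Em lbm; apply: xget_unique => // n [En lbn].
by apply/eqP; rewrite eq_le lbn // lbm.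
Qed.

Lemma continuous_lin_row (R : realType) n (w : 'I_n -> R) :
  continuous (fun u : 'rV[R]_n => \sum_j w j * u 0 j).
Proof.
apply: (@continuous_big R _ _ _ _ (@add_continuous R)) => j _ u.
apply: (@continuousM _ _ (fun=> w j) (fun v : 'rV[R]_n => v 0 j)).
  exact: cst_continuous.
exact: coord_continuous.
Qed.

(** Stated for row vectors, as [rV_compact] is. *)
Lemma compact_flows (R : realType) nv na (G : network nv na)
    (d : 'cV[R]_nv) (f : 'cV[R]_na) :
  compact [set u : 'rV[R]_na | flows G d f u^T].
Proof.
have cbox : compact
    [set u : 'rV[R]_na | forall j, `[0, f j 0]%classic (u ord0 j)].
  apply: (@rV_compact _ _ (fun j => `[0, f j 0]%classic)) => j.
  exact: segment_compact.
apply: subclosed_compact cbox _; last first.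
  move=> u [_ u0 uf] j /=; have := u0 j; have := uf j.
  by rewrite in_itv /= !mxE => -> ->.
rewrite [X in closed X](_ : _ =
   (\bigcap_i [set u : 'rV[R]_na | d i 0 <= \sum_j incidence R G i j * u 0 j])
   `&` (\bigcap_j [set u : 'rV[R]_na | 0 <= u 0 j])
   `&` (\bigcap_j [set u : 'rV[R]_na | u 0 j <= f j 0])).
  apply: closedI; first apply: closedI.
  - apply: closed_bigI => i _; apply: (@closed_comp _ _ _ [set x | d i 0 <= x]).
      by move=> u _; exact: continuous_lin_row.
    exact: closed_ge.
  - apply: closed_bigI => j _.
    apply: (@closed_comp _ _ (fun u : 'rV[R]_na => u 0 j) [set x | 0 <= x]).
      by move=> u _; exact: coord_continuous.
    exact: closed_ge.
  - apply: closed_bigI => j _.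
    apply: (@closed_comp _ _ (fun u : 'rV[R]_na => u 0 j) [set x | x <= f j 0]).
      by move=> u _; exact: coord_continuous.
    exact: closed_le.
have TE (u : 'rV[R]_na) i : (incidence R G *m u^T) i 0
    = \sum_j incidence R G i j * u 0 j.
  by rewrite mxE; apply: eq_bigr => j _; rewrite [u^T _ _]mxE.
apply/seteqP; split=> u.
  move=> [du u0 uf]; split; first split.
  - by move=> i _ /=; rewrite -TE.
  - by move=> j _ /=; have := u0 j; rewrite !mxE.
  - by move=> j _ /=; have := uf j; rewrite !mxE.
move=> [[du u0] uf]; split.
- by move=> i; rewrite TE; exact: du.
- by move=> j; rewrite !mxE; exact: u0.
- by move=> j; rewrite !mxE; exact: uf.
Qed.

Lemma flow_value_attained (R : realType) nv na (G : network nv na)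
    (delta c : 'cV[R]_na) (d : 'cV[R]_nv) (f x z : 'cV[R]_na) :
  flows G d f !=set0 ->
  exists2 y, flows G d f y
    & flow_value G delta c d f x z = dotmx (cost c delta x z) y /\
      forall y', flows G d f y' ->
        flow_value G delta c d f x z <= dotmx (cost c delta x z) y'.
Proof.
move=> [y0 fy0]; set w := cost c delta x z.
have [||u uF umin] := @compact_EVT_min _ R
    (fun u : 'rV[R]_na => \sum_j w j 0 * u 0 j) _ _
    (@compact_flows R nv na G d f).
- by exists y0^T; rewrite /= trmxK.
- by apply: continuous_subspaceT; exact: continuous_lin_row.
have E (v : 'rV[R]_na) : \sum_j w j 0 * v 0 j = dotmx w v^T.
  by rewrite dotmxE; apply: eq_bigr => j _; rewrite [v^T _ _]mxE.
have uF' : flows G d f u^T by have := set_mem uF.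
have vE : flow_value G delta c d f x z = dotmx w u^T.
  apply: minimumP; first by exists u^T.
  move=> _ [y fy <-]; rewrite -[y]trmxK -!E; apply: umin.
  by apply/mem_set; rewrite /= trmxK.
exists u^T => //; split=> // y fy; rewrite vE -[y]trmxK -!E; apply: umin.
by apply/mem_set; rewrite /= trmxK.
Qed.

Local Close Scope classical_set_scope.

Lemma binary_attained (R : realType) n (F : 'cV[R]_n -> R) :
  exists2 z, binary R n z & forall z', binary R n z' -> F z <= F z'.
Proof.
pose vec (b : {ffun 'I_n -> bool}) : 'cV[R]_n := \col_j (b j)%:R.
case: (@arg_minP _ _ _ [ffun=> false] xpredT (F \o vec) isT) => b _ bmin.
exists (vec b) => [j|z bz].
  by rewrite mxE; case: (b j); [right|left].
have -> : z = vec [ffun j => z j 0 == 1].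
  apply/colP => j; rewrite mxE ffunE; case: (bz j) => ->; last by rewrite eqxx.
  by rewrite eq_sym oner_eq0.
exact: bmin.
Qed.

Lemma attack_value_attained (R : realType) nv na (G : network nv na)
    (delta c : 'cV[R]_na) (d : 'cV[R]_nv) (f r x : 'cV[R]_na) :
  (flows G d f !=set0)%classic ->
  exists z y, [/\ binary R na z, flows G d f y
    & attack_value G delta c d f r x
      = dotmx r (const_mx 1 - z) + dotmx (cost c delta x z) y] /\
    forall z' y', binary R na z' -> flows G d f y' ->
      attack_value G delta c d f r x
      <= dotmx r (const_mx 1 - z') + dotmx (cost c delta x z') y'.
Proof.
move=> ne; have [z bz zmin] := binary_attained
  (fun z => dotmx r (const_mx 1 - z) + flow_value G delta c d f x z).
have vE : attack_value G delta c d f r x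
    = dotmx r (const_mx 1 - z) + flow_value G delta c d f x z.
  apply: minimumP; first by exists z.
  by move=> _ [z' bz' <-]; exact: zmin.
have [y fy [yE _]] := flow_value_attained delta c x z ne.
exists z, y; split; first by split=> //; rewrite vE yE.
move=> z' y' bz' fy'; rewrite vE; apply: le_trans (zmin _ bz') _.
have [_ _ [_ ymin]] := flow_value_attained delta c x z' ne.
by rewrite lerD2l ymin.
Qed.

(** * Submodularity *)

Lemma rearrangement (R : realDomainType) (a b p q : R) :
  Num.max a b * Num.min p q + Num.min a b * Num.max p q <= a * p + b * q.
Proof.
have [ab|ba] := leP a b; have [pq|qp] := leP p q; try lra.
  by have : 0 <= (b - a) * (q - p) by [apply: mulr_ge0; lra]; lra.
by have : 0 <= (a - b) * (p - q) by [apply: mulr_ge0; lra]; lra.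
Qed.

Lemma binary_max_min (R : realType) n (z z' : 'cV[R]_n) :
  binary R n z -> binary R n z' ->
  binary R n (map2_mx Num.max z z') /\ binary R n (map2_mx Num.min z z').
Proof.
by move=> bz bz'; split=> j; rewrite mxE; case: leP => _.
Qed.

Lemma costE (R : realType) na (c delta x z : 'cV[R]_na) j :
  cost c delta x z j 0 = c j 0 + delta j 0 * (x j 0 + z j 0 - 1).
Proof. by rewrite /cost mul_diag_mx !mxE. Qed.

Theorem proposition15 (R : realType) (nv na : nat) (G : network nv na)
  (Aa : {set 'I_na}) (delta : 'cV[R]_na)
  (delta_ge0 : forall j, 0 <= delta j 0)
  (delta_supp : forall j, j \notin Aa -> delta j 0 = 0)
  (same_dir : forall (k : nat) (v : nat -> 'I_nv) (a : nat -> 'I_na),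
     is_path G k v a ->
     forall i j : nat, (1 <= i <= k)%N -> (1 <= j <= k)%N ->
       a i \in Aa -> a j \in Aa -> a i != a j -> same_direction G v a i j)
  (c : 'cV[R]_na) (d : 'cV[R]_nv) (f r : 'cV[R]_na)
  (f_ge0 : forall j, 0 <= f j 0)
  (r_gt0 : forall j, 0 < r j 0)
  (recourse : complete_recourse G delta c d f r) :
  submodular (binary R na) (attack_value G delta c d f r).
Proof.
move=> x x' bx bx'.
have feasible : (flows G d f !=set0)%classic.
  by have [[_ [[z y] [_ fy] _]] _] := recourse _ bx; exists y.
have [z [y [[bz fy ->] _]]] :=
  attack_value_attained delta c r x feasible.
have [z' [y' [[bz' fy' ->] _]]] :=
  attack_value_attained delta c r x' feasible.
have [u [u' [fu fu' uu' uA u'A]]] := flows_exchange same_dir fy fy'.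
have [bmax bmin] := binary_max_min bz bz'.
have [_ [_ [_ /(_ _ _ bmax fu) leM]]] :=
  attack_value_attained delta c r (map2_mx Num.max x x') feasible.
have [_ [_ [_ /(_ _ _ bmin fu') lem]]] :=
  attack_value_attained delta c r (map2_mx Num.min x x') feasible.
apply: le_trans (lerD leM lem) _.
rewrite !dotmxE -!big_split /=; apply: ler_sum => j _.
rewrite !costE !mxE.
(* The claim on arc [j] is linear in the products that [rz], [cu], [du] and the
   rearrangement inequalities relate. *)
have /colP/(_ j) := uu'; rewrite !mxE => uuE.
have zE := addr_max_min (z j 0) (z' j 0).
have rz := congr1 ( *%R (r j 0)) zE.
have cu := congr1 ( *%R (c j 0)) uuE.
have [jA|/delta_supp ->] := boolP (j \in Aa); last by lra.
have du := congr1 ( *%R (delta j 0)) uuE.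
have := rearrangement (x j 0) (x' j 0) (y j 0) (y' j 0).
have := rearrangement (z j 0) (z' j 0) (y j 0) (y' j 0).
rewrite -uA // -u'A // -[_ <= _]subr_ge0 => zy; rewrite -[_ <= _]subr_ge0 => xy.
have := mulr_ge0 (delta_ge0 j) (addr_ge0 zy xy).
lra.
Qed.
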